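(* Let $W$ be a discrete memoryless channel with input alphabet $\mathcal X=\{1,\dots,J\}$ and output alphabet $\mathcal Y=\{1,\dots,K\}$, and let $q:\mathcal X\times\mathcal Y\to\mathbb R$ be a decoding metric. Then $$C_q(W)\le \bar R(W,q):=\max_{P_X}\ \min_{\substack{P_{Y\hat Y|X}\in\mathcal M_{\max}(q,P_X)\\ P_{Y|X}=W}} I(P_X,P_{\hat Y|X}),$$ where the maximum is over probability mass functions $P_X$ on $\mathcal X$, $P_{Y|X}$ and $P_{\hat Y|X}$ denote the two marginal conditional distributions of $P_{Y\hat Y|X}$, and $I(P_X,P_{\hat Y|X})$ is the mutual information between input and output when the input has law $P_X$ and the channel is $P_{\hat Y|X}$.
   Context: A DMC $W$ is a conditional pmf $W(k|j)$ on $\mathcal Y$ given $\mathcal X$, used as $W^n(\mathbf y|\mathbf x)=\prod_{i=1}^n W(y_i|x_i)$. For a codebook $\mathcal C_n=\{\mathbf x_1,\dots,\mathbf x_M\}\subset\mathcal X^n$, a message $m$ is chosen uniformly, $\mathbf x_m$ is sent, and the $q$-decoder outputs $\hat m=\arg\max_{m'} q^n(\mathbf x_{m'},\mathbf y)$ where $q^n(\mathbf x,\mathbf y)=\sum_{i=1}^n q(x_i,y_i)$ (an error occurs whenever some $\bar m\neq m$ has $q^n(\mathbf x_{\bar m},\mathbf y)\ge q^n(\mathbf x_m,\mathbf y)$). $P_e^q(\mathcal C_n,W)$ is the average error probability. A rate $R>0$ is achievable if for every $\epsilon>0$ there is a sequence of codebooks with $|\mathcal C_n|\ge 2^{n(R-\epsilon)}$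 and $\liminf_{n\to\infty} P_e^q(\mathcal C_n,W)=0$; the mismatch capacity $C_q(W)$ is the supremum of achievable rates. For a pmf $P_{X_1}$ on $\mathcal X$, $\mathcal M_{\max}(q,P_{X_1})$ is the set of all conditional pmfs $P_{Y\hat Y|X_1}$ on $\mathcal Y\times\mathcal Y$ given $\mathcal X$ such that, for every conditional pmf $P_{X_2|X_1\hat Y}$ on $\mathcal X$ given $\mathcal X\times\mathcal Y$ for which, under the joint law $P_{X_1}(x_1)P_{Y\hat Y|X_1}(y,\hat y|x_1)P_{X_2|X_1\hat Y}(x_2|x_1,\hat y)$ (so that $X_2-(X_1,\hat Y)-Y$ is a Markov chain), the marginals satisfy $P_{\hat Y X_2}=P_{\hat Y X_1}$, one has $\mathbb E[q(X_2,Y)]\ge \mathbb E[q(X_1,Y)]$. *)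

(* Defs.v *)
From mathcomp Require Import all_boot all_order all_algebra.
From mathcomp Require Import all_classical all_reals all_analysis.
Set Implicit Arguments. Unset Strict Implicit. Unset Printing Implicit Defensive.
Import Order.TTheory GRing.Theory Num.Theory.
Local Open Scope classical_set_scope.
Local Open Scope ring_scope.

Section Mismatch.
Variable R : realType.
Variables J K : nat.
Notation X := 'I_J.
Notation Y := 'I_K.

Definition is_pmf (T : finType) (p : T -> R) : Prop :=
  (forall t, 0 <= p t) /\ \sum_(t : T) p t = 1.

Definition is_cond_pmf (S T : finType) (W : S -> T -> R) : Prop :=
  forall s, is_pmf (W s).

Definition chan_n (W : X -> Y -> R) (n : nat)
  (x : {ffun 'I_n -> X}) (y : {ffun 'I_n -> Y}) : R :=
  \prod_(i < n) W (x i) (y i).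

Definition metric_n (q : X -> Y -> R) (n : nat)
  (x : {ffun 'I_n -> X}) (y : {ffun 'I_n -> Y}) : R :=
  \sum_(i < n) q (x i) (y i).

Definition codebook (n M : nat) := 'I_M -> {ffun 'I_n -> X}.

Definition err_prob (q : X -> Y -> R) (W : X -> Y -> R) (n M : nat)
  (C : codebook n M) : R :=
  M%:R^-1 * \sum_(m < M) \sum_(y : {ffun 'I_n -> Y})
     (if [exists m' : 'I_M, (m' != m) &&
            (metric_n q (C m) y <= metric_n q (C m') y)]
      then chan_n W (C m) y else 0).

Definition achievable (q : X -> Y -> R) (W : X -> Y -> R) (r : R) : Prop :=
  0 < r /\
  forall eps : R, 0 < eps ->
    exists (M : nat -> nat) (C : forall n, codebook n (M n)),
      (forall n, 2 `^ (n%:R * (r - eps)) <= (M n)%:R) /\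
      limn_inf (fun n => err_prob q W (C n)) = 0.

Definition mismatch_capacity (q : X -> Y -> R) (W : X -> Y -> R) : R :=
  sup [set r | achievable q W r].

(* P_{Y Yhat | X1} is represented as V : X -> Y * Y -> R, V x1 (y, yhat) *)
Definition M_max (q : X -> Y -> R) (P : X -> R) : set (X -> Y * Y -> R) :=
  [set V | is_cond_pmf V /\
    forall U : X -> Y -> X -> R,   (* U x1 yhat x2 = P_{X2|X1 Yhat} *)
      (forall x1 yh, is_pmf (U x1 yh)) ->
      (* P_{Yhat X2} = P_{Yhat X1} *)
      (forall (yh : Y) (x : X),
         \sum_(x1 : X) \sum_(y : Y) P x1 * V x1 (y, yh) * U x1 yh x
         = \sum_(y : Y) P x * V x (y, yh)) ->
      (* E[q(X2,Y)] >= E[q(X1,Y)] *)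
      \sum_(x1 : X) \sum_(y : Y) \sum_(yh : Y) \sum_(x2 : X)
          P x1 * V x1 (y, yh) * U x1 yh x2 * q x2 y
      >= \sum_(x1 : X) \sum_(y : Y) \sum_(yh : Y) P x1 * V x1 (y, yh) * q x1 y].

Definition margY (V : X -> Y * Y -> R) : X -> Y -> R :=
  fun x y => \sum_(yh : Y) V x (y, yh).
Definition margYhat (V : X -> Y * Y -> R) : X -> Y -> R :=
  fun x yh => \sum_(y : Y) V x (y, yh).

(* mutual information I(P_X, V) in bits, with 0 log 0 = 0 *)
Definition mutual_info (P : X -> R) (V : X -> Y -> R) : R :=
  \sum_(x : X) \sum_(y : Y)
    (if P x * V x y == 0 then 0
     else P x * V x y * (ln (V x y / \sum_(x' : X) P x' * V x' y) / ln 2)).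

Definition Rbar (W : X -> Y -> R) (q : X -> Y -> R) : R :=
  sup [set inf [set mutual_info P (margYhat V) |
                V in [set V | M_max q P V /\ margY V = W]]
      | P in [set P : X -> R | is_pmf P]].

End Mismatch.

(* Main.v *)
Require Import Defs.
From mathcomp Require Import all_boot all_order all_algebra.
From mathcomp Require Import all_classical all_reals all_analysis.
From mathcomp Require Import ring lra.
Set Implicit Arguments. Unset Strict Implicit. Unset Printing Implicit Defensive.
Import Order.TTheory GRing.Theory Num.Theory.
Import numFieldNormedType.Exports.
Local Open Scope ring_scope.

(** Suppose [rho > Rbar W q].  For every input law [P] there is [V] in [M_max q P]
    with [Y]-marginal [W] and [I(P, margYhat V) < rho].  Take many codewords of
    composition close to [P] and send a random one, [x], through [V], with
    outputs [y] and [yhat].  The rate exceeds the information carried by [yhat],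
    so with probability at least 1/2 another codeword [x'] has the same joint
    type with [yhat] as [x] has.  The joint type of [(x, yhat, x')] is then a
    perturbation direction for the identity kernel that is admissible in the
    definition of [M_max], so given [x], [x'] and [yhat] the metric difference
    of [x'] and [x] has nonnegative mean.  It is a sum of independent terms with
    finitely many possible laws, hence it is nonnegative with probability
    bounded below.  Compactness of the simplex makes the bound uniform in the
    composition. *)

(** * Moments of sums of independent variables *)

Definition ffun_cons {T : finType} {n : nat} (a : T) (g : {ffun 'I_n -> T}) :
  {ffun 'I_n.+1 -> T} := [ffun i => if unlift ord0 i is Some j then g j else a].

Lemma ffun_cons0 (T : finType) (n : nat) (a : T) (g : {ffun 'I_n -> T}) :
  ffun_cons a g ord0 = a.
Proof. by rewrite ffunE unlift_none. Qed.

Lemma ffun_consS (T : finType) (n : nat) (a : T) (g : {ffun 'I_n -> T}) i :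
  ffun_cons a g (lift ord0 i) = g i.
Proof. by rewrite ffunE liftK. Qed.

Lemma sum_ffunS (R : realType) (T : finType) (n : nat)
    (F : {ffun 'I_n.+1 -> T} -> R) :
  \sum_f F f = \sum_a \sum_(g : {ffun 'I_n -> T}) F (ffun_cons a g).
Proof.
rewrite pair_bigA /= (reindex (fun p : T * {ffun 'I_n -> T} => ffun_cons p.1 p.2)) //=.
exists (fun f : {ffun 'I_n.+1 -> T} => (f ord0, [ffun i => f (lift ord0 i)])).
  move=> [a g] _ /=; rewrite ffun_cons0; congr pair.
  by apply/ffunP => i; rewrite ffunE ffun_consS.
move=> f _ /=; apply/ffunP => i; rewrite ffunE.
by case: unliftP => [j ->|->] //; rewrite ffunE.
Qed.

Lemma prod_pmf (R : realType) (T : finType) (n : nat) (w : 'I_n -> T -> R) :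
  (forall i, is_pmf (w i)) ->
  is_pmf (fun f : {ffun 'I_n -> T} => \prod_i w i (f i)).
Proof.
move=> wP; split=> [f|].
  by apply: prodr_ge0 => i _; have [+ _] := wP i; apply.
rewrite -(bigA_distr_bigA w) /=.
by apply: big1 => i _; have [_] := wP i.
Qed.

Definition moment {R : realType} {T : finType} {n : nat} (w z : 'I_n -> T -> R)
    (k : nat) : R :=
  \sum_(f : {ffun 'I_n -> T}) (\prod_i w i (f i)) * (\sum_i z i (f i)) ^+ k.

(** Expanding the power binomially around the first coordinate turns independence into a recursion
    on [n]. *)
Lemma momentS (R : realType) (T : finType) (n : nat)
    (w z : 'I_n.+1 -> T -> R) (k : nat) :
  let w' := fun i => w (lift ord0 i) in let z' := fun i => z (lift ord0 i) in
  moment w z k =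
  \sum_(j < k.+1) (\sum_a w ord0 a * z ord0 a ^+ (k - j)) * moment w' z' j *+ 'C(k, j).
Proof.
move=> w' z'.
rewrite /moment sum_ffunS.
transitivity (\sum_a \sum_(g : {ffun 'I_n -> T}) \sum_(j < k.+1)
   (w ord0 a * z ord0 a ^+ (k - j)) *
     ((\prod_i w' i (g i)) * (\sum_i z' i (g i)) ^+ j) *+ 'C(k, j)).
  apply: eq_bigr => a _; apply: eq_bigr => g _.
  have -> : \prod_i w i (ffun_cons a g i) = w ord0 a * \prod_i w' i (g i).
    rewrite big_ord_recl ffun_cons0; congr (_ * _).
    by apply: eq_bigr => i _; rewrite ffun_consS.
  have -> : \sum_i z i (ffun_cons a g i) = z ord0 a + \sum_i z' i (g i).
    rewrite big_ord_recl ffun_cons0; congr (_ + _).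
    by apply: eq_bigr => i _; rewrite ffun_consS.
  rewrite exprDn big_distrr /=; apply: eq_bigr => j _.
  by rewrite -!mulrnAr; ring.
under eq_bigr do rewrite exchange_big /=.
rewrite exchange_big /=; apply: eq_bigr => j _.
under eq_bigr do rewrite sumrMnl -mulr_sumr.
by rewrite sumrMnl -mulr_suml.
Qed.

Lemma moment0 (R : realType) (T : finType) (n : nat) (w z : 'I_n -> T -> R) :
  (forall i, is_pmf (w i)) -> moment w z 0 = 1.
Proof.
move=> wP; have [_ <-] := prod_pmf wP.
by apply: eq_bigr => f _; rewrite expr0 mulr1.
Qed.

Lemma moment_nil (R : realType) (T : finType) (w z : 'I_0 -> T -> R) (k : nat) :
  moment w z k.+1 = 0.
Proof. by apply: big1 => f _; rewrite [X in X ^+ _]big_ord0 expr0n mulr0. Qed.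

Lemma moment1 (R : realType) (T : finType) (n : nat) (w z : 'I_n -> T -> R) :
  (forall i, is_pmf (w i)) -> (forall i, \sum_a w i a * z i a = 0) ->
  moment w z 1 = 0.
Proof.
elim: n w z => [|n IH] w z wP z0; first exact: moment_nil.
rewrite momentS /= !big_ord_recl big_ord0 /= /bump /=.
rewrite IH ?mulr0 // ?mul0rn.
under eq_bigr do rewrite expr1.
by rewrite z0; ring.
Qed.

Lemma moment2 (R : realType) (T : finType) (n : nat) (w z : 'I_n -> T -> R) :
  (forall i, is_pmf (w i)) -> (forall i, \sum_a w i a * z i a = 0) ->
  moment w z 2 = \sum_i \sum_a w i a * z i a ^+ 2.
Proof.
elim: n w z => [|n IH] w z wP z0; first by rewrite big_ord0 moment_nil.
rewrite momentS /= !big_ord_recl big_ord0 /= /bump /=.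
rewrite IH //.
rewrite moment1 //.
rewrite moment0 // mulr1 mulr0.
have -> : \sum_a w ord0 a * z ord0 a ^+ (2 - 2) = 1.
  have [_ <-] := wP ord0; by apply: eq_bigr => a _; rewrite expr0 mulr1.
by rewrite mul0rn add0r addr0 mul1r !mulr1n.
Qed.

(** Centring kills the terms of odd order in the recursion. With [v] and [s] the variances of the
    first coordinate and of the rest, what remains is at most [D * v ^+ 2 + 6 * v * s + (3 + D) * s
    ^+ 2], which is below [(3 + D) * (v + s) ^+ 2]. *)
Lemma moment4_le (R : realType) (T : finType) (n : nat) (w z : 'I_n -> T -> R) (D : R) :
  0 <= D ->
  (forall i, is_pmf (w i)) -> (forall i, \sum_a w i a * z i a = 0) ->
  (forall i, \sum_a w i a * z i a ^+ 4 <= D * (\sum_a w i a * z i a ^+ 2) ^+ 2) ->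
  moment w z 4 <= (3 + D) * (\sum_i \sum_a w i a * z i a ^+ 2) ^+ 2.
Proof.
move=> D0; elim: n w z => [|n IH] w z wP z0 z4.
  by rewrite big_ord0 moment_nil expr0n mulr0.
rewrite momentS /= 5![in leLHS]big_ord_recl big_ord0 /= /bump /=.
rewrite big_ord_recl.
rewrite moment2 //.
rewrite moment1 //.
rewrite moment0 // mulr1 mulr0 bin0 !binn.
have -> : \sum_a w ord0 a * z ord0 a ^+ (4 - 4) = 1.
  have [_ <-] := wP ord0; by apply: eq_bigr => a _; rewrite expr0 mulr1.
have -> : \sum_a w ord0 a * z ord0 a ^+ (4 - (1 + (1 + 1))) = 0.
  by rewrite -[RHS](z0 ord0); apply: eq_bigr => a _; rewrite expr1.
rewrite (_ : 4 - (1 + 1) = 2)%N // (_ : 'C(4, 1 + 1) = 6)%N //.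
have {}IH := IH (fun i => w (lift ord0 i)) (fun i => z (lift ord0 i))
  (fun i => wP _) (fun i => z0 _) (fun i => z4 _).
have {}z4 := z4 ord0.
have v0 : 0 <= \sum_a w ord0 a * z ord0 a ^+ 2.
  by apply: sumr_ge0 => a _; rewrite mulr_ge0 ?sqr_ge0 //; have [+ _] := wP ord0; apply.
have s0 : 0 <= \sum_(i < n) \sum_a w (lift ord0 i) a * z (lift ord0 i) a ^+ 2.
  apply: sumr_ge0 => i _.
  by apply: sumr_ge0 => a _; rewrite mulr_ge0 ?sqr_ge0 //; have [+ _] := wP (lift ord0 i); apply.
rewrite mul0r !mul0rn !addr0 add0r mul1r.
move: z4 IH v0 s0.
rewrite subn0 !mulr1n add0r.
set m4 := \sum_a _ * _ ^+ 4; set v := \sum_a w ord0 a * _ ^+ 2.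
set s := \sum_(i < n) \sum_a _; set M := moment _ _ _.
move=> z4 IH v0 s0.
have := mulr_ge0 v0 s0; have := mulr_ge0 D0 (mulr_ge0 v0 s0); have := sqr_ge0 v.
rewrite -mulr_natr; nra.
Qed.

(* A quartic polynomial below the indicator of [0 <= S] whose mean only involves
   the first, second and fourth moments. *)
Lemma pmf_nonneg_ge (R : realType) (O : finType) (p S : O -> R) (kappa : R) :
  is_pmf p -> 1 <= kappa -> \sum_o p o * S o = 0 ->
  \sum_o p o * S o ^+ 4 <= kappa * (\sum_o p o * S o ^+ 2) ^+ 2 ->
  (48 * kappa ^+ 2)^-1 <= \sum_o (if 0 <= S o then p o else 0).
Proof.
move=> [p0 p1] k1 S1 S4.
set v := \sum_o p o * S o ^+ 2 in S4.
have v0 : 0 <= v by apply: sumr_ge0 => o _; rewrite mulr_ge0 ?sqr_ge0.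
have k0 : 0 < kappa by lra.
(* With zero variance, [S] vanishes wherever [p] does not, so the event has full mass. *)
have [v_eq0|v_neq0] := eqVneq v 0.
  have pS o : p o * S o ^+ 2 = 0.
    have := psumr_eq0P (P := predT) (F := fun o => p o * S o ^+ 2).
    by move=> /(_ (fun o _ => mulr_ge0 (p0 o) (sqr_ge0 _)) v_eq0) ->.
  rewrite (_ : \sum_o _ = 1); last first.
    rewrite -p1; apply: eq_bigr => o _; case: ifPn => // So.
    have /eqP := pS o; rewrite mulf_eq0 sqrf_eq0 => /orP[/eqP->//|/eqP So0].
    by rewrite So0 lexx in So.
  by rewrite invf_le1; nra.
have v_gt0 : 0 < v by rewrite lt_def v_neq0.
set s := Num.sqrt v.
have s_gt0 : 0 < s by rewrite sqrtr_gt0.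
have s2 : s ^+ 2 = v by rewrite sqr_sqrtr.
(* In the unit [u = S o / s] the quartic is [4 * kappa ^+ 2 * u + 2 * kappa * u ^+ 2 - u ^+ 4]. It
   is nonpositive for [u < 0]; for [u >= 0] the value [u = 4 * kappa] in its first two terms gives
   [48 * kappa ^+ 3], and beyond that point [u ^+ 4] dominates. *)
have pt o : 4 * kappa ^+ 2 * s ^+ 3 * S o + 2 * kappa * v * S o ^+ 2 - S o ^+ 4 <=
    48 * kappa ^+ 3 * v ^+ 2 * (if 0 <= S o then 1 else 0).
  rewrite -s2.
  have -> : S o = (S o / s) * s by rewrite divfK // gt_eqF.
  rewrite pmulr_lge0 //.
  set u := S o / s.
  have -> : 4 * kappa ^+ 2 * s ^+ 3 * (u * s) + 2 * kappa * s ^+ 2 * (u * s) ^+ 2 -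
    (u * s) ^+ 4 = s ^+ 4 * (4 * kappa ^+ 2 * u + 2 * kappa * u ^+ 2 - u ^+ 4) by ring.
  have -> : forall c : R, 48 * kappa ^+ 3 * (s ^+ 2) ^+ 2 * c =
    s ^+ 4 * (48 * kappa ^+ 3 * c) by move=> c; ring.
  rewrite ler_pM2l ?exprn_gt0 //.
  case: ifPn => u0.
    rewrite mulr1; have [uk|uk] := leP u (4 * kappa).
      have A : u ^+ 2 <= 16 * kappa ^+ 2 by nra.
      have B : kappa * u ^+ 2 <= 16 * kappa ^+ 3.
        by rewrite (_ : 16 * kappa ^+ 3 = kappa * (16 * kappa ^+ 2)) ?ler_pM2l //; ring.
      have C : kappa ^+ 2 * u <= 4 * kappa ^+ 3.
        by rewrite (_ : 4 * kappa ^+ 3 = kappa ^+ 2 * (4 * kappa)) ?ler_pM2l ?exprn_gt0 //; ring.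
      have E : 0 <= u ^+ 4 by rewrite exprn_ge0.
      lra.
    have A : 16 * kappa ^+ 2 <= u ^+ 2 by nra.
    have A' : 16 * kappa <= u ^+ 2 by apply: le_trans A; nra.
    have k30 : 0 <= kappa ^+ 3 by rewrite exprn_ge0 // ltW.
    have B : 16 * kappa * u ^+ 2 <= u ^+ 4.
      by rewrite (_ : u ^+ 4 = u ^+ 2 * u ^+ 2); [rewrite ler_wpM2r ?sqr_ge0|ring].
    have C : kappa ^+ 2 * u <= kappa * u ^+ 2.
      rewrite -subr_ge0 (_ : _ - _ = kappa * u * (u - kappa)); last by ring.
      by apply: mulr_ge0; [apply: mulr_ge0 => //; lra|lra].
    have E : 0 <= kappa * u ^+ 2 by rewrite mulr_ge0 ?sqr_ge0 // ltW.
    lra.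
  rewrite mulr0; rewrite -ltNge in u0.
  have -> : 4 * kappa ^+ 2 * u + 2 * kappa * u ^+ 2 - u ^+ 4 =
    - u * (2 * kappa * (- u) - 4 * kappa ^+ 2 - (- u) ^+ 3) by ring.
  set y := - u; have y0 : 0 < y by rewrite /y; lra.
  rewrite pmulr_rle0 //.
  have [uk|uk] := leP y (2 * kappa).
    have : 0 <= y ^+ 3 by rewrite exprn_ge0 // ltW.
    by nra.
  have A : 2 * kappa <= y ^+ 2 by nra.
  have B : 2 * kappa * y <= y ^+ 3 by rewrite (_ : y ^+ 3 = y ^+ 2 * y); [rewrite ler_pM2r|ring].
  nra.
have sumpt : 2 * kappa * v ^+ 2 - \sum_o p o * S o ^+ 4 <=
    48 * kappa ^+ 3 * v ^+ 2 * \sum_o (if 0 <= S o then p o else 0).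
  have -> : 2 * kappa * v ^+ 2 - \sum_o p o * S o ^+ 4 =
    \sum_o p o * (4 * kappa ^+ 2 * s ^+ 3 * S o + 2 * kappa * v * S o ^+ 2 - S o ^+ 4).
    transitivity (4 * kappa ^+ 2 * s ^+ 3 * (\sum_o p o * S o) + 2 * kappa * v *
      (\sum_o p o * S o ^+ 2) - \sum_o p o * S o ^+ 4); first by rewrite S1 -/v; ring.
    rewrite !mulr_sumr -sumrN -!big_split /=.
    by apply: eq_bigr => o _; ring.
  rewrite [leRHS]mulr_sumr; apply: ler_sum => o _.
  apply: le_trans (ler_wpM2l (p0 o) (pt o)) _.
  by case: ifP => _; rewrite ?mulr1 ?mulr0 // mulrC.
have : kappa * v ^+ 2 * 1 <=
    kappa * v ^+ 2 * (48 * kappa ^+ 2 * \sum_o (if 0 <= S o then p o else 0)).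
  apply: le_trans (_ : _ <= 2 * kappa * v ^+ 2 - \sum_o p o * S o ^+ 4) _; first by lra.
  by apply: le_trans sumpt _; rewrite le_eqVlt; apply/orP; left; apply/eqP; ring.
rewrite ler_pM2l ?mulr_gt0 ?exprn_gt0 // => H.
by rewrite -[leLHS]mul1r ler_pdivrMr ?mulr_gt0 ?exprn_gt0 // mulrC.
Qed.

(** * Metric differences under a maximal channel *)

Lemma sum_delta (R : realType) (T : finType) (u : T) (F : T -> R) :
  \sum_a (u == a)%:R * F a = F u.
Proof.
rewrite (bigD1 u) //= eqxx mul1r big1 ?addr0 // => a /negbTE au.
by rewrite eq_sym au mul0r.
Qed.

(** The conditional mean of the metric difference given input [a] and auxiliary output [b]; it is 0
    by division when [margYhat V a b = 0]. *)
Definition drift {R : realType} {J K : nat} (q : 'I_J -> 'I_K -> R)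
    (V : 'I_J -> 'I_K * 'I_K -> R) (a : 'I_J) (b : 'I_K) (c : 'I_J) : R :=
  \sum_y V a (y, b) / margYhat V a b * (q c y - q a y).

Lemma drift_diag (R : realType) (J K : nat) (q : 'I_J -> 'I_K -> R)
    (V : 'I_J -> 'I_K * 'I_K -> R) a b : drift q V a b a = 0.
Proof. by apply: big1 => y _; rewrite subrr mulr0. Qed.

Lemma margYhat_drift (R : realType) (J K : nat) (q : 'I_J -> 'I_K -> R)
    (V : 'I_J -> 'I_K * 'I_K -> R) a b c :
  is_cond_pmf V ->
  margYhat V a b * drift q V a b c = \sum_y V a (y, b) * (q c y - q a y).
Proof.
move=> VP; have V0 y : 0 <= V a (y, b) by have [+ _] := VP a; apply.
rewrite /drift mulr_sumr; have [m0|m0] := eqVneq (margYhat V a b) 0.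
  apply: eq_bigr => y _; rewrite m0 mul0r.
  have := psumr_eq0P (P := predT) (F := fun y => V a (y, b)).
  by move=> /(_ (fun y _ => V0 y) m0) ->; rewrite ?mul0r.
by apply: eq_bigr => y _; field.
Qed.

(* A small multiple of the empirical coupling of [x] and [x'] perturbs the
   identity kernel to a kernel [U] allowed in the definition of [M_max]; only
   the support of [P * margYhat V] matters, not the empirical frequencies. *)
Lemma M_max_drift_ge0 (R : realType) (J K n : nat) (q : 'I_J -> 'I_K -> R)
    (P : 'I_J -> R) (V : 'I_J -> 'I_K * 'I_K -> R)
    (x x' : {ffun 'I_n -> 'I_J}) (yh : {ffun 'I_n -> 'I_K}) :
  is_pmf P -> M_max q P V ->
  (forall i, 0 < margYhat V (x i) (yh i)) ->
  (forall i, P (x i) = 0 -> x i = x' i) ->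
  (forall a b, \sum_i ((x i == a) && (yh i == b))%:R =
               \sum_i ((x' i == a) && (yh i == b))%:R :> R) ->
  0 <= \sum_i drift q V (x i) (yh i) (x' i).
Proof.
move=> [P0 P1] [VP VM] Vpos rare cnt.
(* Only positions where the codewords differ are kept. By [rare] these have [P (x i) != 0], so the
   counts below vanish wherever [p] does. *)
pose d i : R := (x i != x' i)%:R.
pose N a b c : R := \sum_i d i * ((x i == a)%:R * (yh i == b)%:R * (x' i == c)%:R).
pose rowN a b : R := \sum_i d i * ((x i == a)%:R * (yh i == b)%:R).
pose colN b c : R := \sum_i d i * ((yh i == b)%:R * (x' i == c)%:R).
pose p a b := P a * margYhat V a b.
have V0 a y : 0 <= V a y by have [+ _] := VP a; apply.
have p0 a b : 0 <= p a b by rewrite mulr_ge0 // sumr_ge0.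
have N0 a b c : 0 <= N a b c by apply: sumr_ge0 => i _; rewrite !mulr_ge0 ?ler0n.
have rN0 a b : 0 <= rowN a b by apply: sumr_ge0 => i _; rewrite !mulr_ge0 ?ler0n.
have sumN a b : \sum_c N a b c = rowN a b.
  rewrite exchange_big /=; apply: eq_bigr => i _.
  rewrite -[RHS](sum_delta (x' i) (fun=> d i * ((x i == a)%:R * (yh i == b)%:R))).
  by apply: eq_bigr => c _; ring.
have sumNc b c : \sum_a N a b c = colN b c.
  rewrite exchange_big /=; apply: eq_bigr => i _.
  rewrite -[RHS](sum_delta (x i) (fun=> d i * ((yh i == b)%:R * (x' i == c)%:R))).
  by apply: eq_bigr => a _; ring.
(* Positions where [x] and [x'] agree cancel in [cnt], so the balance survives the restriction by
   [d]. *)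
have bal a b : rowN a b = colN b a.
  apply/eqP; rewrite -subr_eq0; apply/eqP.
  transitivity (\sum_i ((x i == a) && (yh i == b))%:R -
    \sum_i ((x' i == a) && (yh i == b))%:R : R); last by rewrite cnt subrr.
  rewrite /rowN /colN -!sumrB; apply: eq_bigr => i _; rewrite /d -!natrM !mulnb.
  have [->|_] := eqVneq (x i) (x' i); first by rewrite /= !subrr.
  by rewrite /= [(x' i == a) && _]andbC.
have rowN_p a b : p a b = 0 -> rowN a b = 0.
  move=> pab; apply: big1 => i _; rewrite /d.
  have [//|xx'] := eqVneq (x i) (x' i); rewrite ?mul0r //.
  case: eqP => [xa|]; rewrite ?mul0r ?mulr0 //.
  case: eqP => [yb|]; rewrite ?mul0r ?mulr0 //.
  move/eqP: pab; rewrite /p mulf_eq0 -xa -yb (gt_eqF (Vpos i)) orbF => /eqP /rare xx.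
  by rewrite xx eqxx in xx'.
have N_le a b c : N a b c <= rowN a b.
  by rewrite -sumN (bigD1 c) //= lerDl; apply: sumr_ge0.
have N_p a b c : p a b = 0 -> N a b c = 0.
  by move=> /rowN_p r0; apply/eqP; rewrite eq_le N0 -r0 N_le.
(* Small enough for every [e * (rowN a b / p a b)] to be at most 1, which keeps the diagonal of [U]
   nonnegative. *)
pose e : R := (1 + \sum_a \sum_b rowN a b / p a b)^-1.
have S0 : 0 <= \sum_a \sum_b rowN a b / p a b.
  by apply: sumr_ge0 => a _; apply: sumr_ge0 => b _; rewrite divr_ge0.
have e0 : 0 < e by rewrite invr_gt0; lra.
have e_le a b : e * (rowN a b / p a b) <= 1.
  rewrite /e mulrC ler_pdivrMr ?mul1r; last by lra.
  suff : rowN a b / p a b <= \sum_a \sum_b rowN a b / p a b by lra.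
  rewrite (bigD1 a) //= (bigD1 b) //= -addrA lerDl.
  rewrite addr_ge0 // sumr_ge0 // => i _; rewrite ?divr_ge0 //.
  by apply: sumr_ge0 => j _; rewrite divr_ge0.
(* Where [p a b = 0] the divisions give [0] and [U a b] is the identity kernel. *)
pose U a b c := (a == c)%:R * (1 - e * (rowN a b / p a b)) + e * (N a b c / p a b).
have U_pmf a b : is_pmf (U a b).
  split=> [c|].
    rewrite addr_ge0 // !mulr_ge0 ?ler0n ?subr_ge0 ?(ltW e0) // ?invr_ge0 ?p0 //.
  rewrite big_split /= sum_delta -mulr_sumr -mulr_suml sumN; ring.
have pU a b c : p a b * U a b c = (a == c)%:R * (p a b - e * rowN a b) + e * N a b c.
  rewrite /U; have [pab|pab] := eqVneq (p a b) 0; last by field.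
  by rewrite (rowN_p _ _ pab) (N_p _ _ _ pab) pab; ring.
have marg yh' c : \sum_x1 \sum_y P x1 * V x1 (y, yh') * U x1 yh' c =
    \sum_y P c * V c (y, yh').
  transitivity (\sum_a p a yh' * U a yh' c).
    by apply: eq_bigr => a _; rewrite -mulr_suml -mulr_sumr.
  rewrite -mulr_sumr -/(p c yh').
  under eq_bigr do rewrite pU eq_sym.
  by rewrite big_split /= sum_delta -mulr_sumr sumNc bal; ring.
have := VM U U_pmf marg.
rewrite -subr_ge0.
have -> : \sum_x1 \sum_y \sum_b \sum_x2 P x1 * V x1 (y, b) * U x1 b x2 * q x2 y -
    \sum_x1 \sum_y \sum_b P x1 * V x1 (y, b) * q x1 y =
  \sum_a \sum_b \sum_c p a b * U a b c * drift q V a b c.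
  rewrite -sumrB; apply: eq_bigr => a _.
  rewrite -sumrB.
  transitivity (\sum_y \sum_b \sum_c P a * V a (y, b) * U a b c * (q c y - q a y)).
    apply: eq_bigr => y _; rewrite -sumrB; apply: eq_bigr => b _.
    have [_ U1] := U_pmf a b.
    rewrite -[X in _ - X]mulr1 -U1 mulr_sumr -sumrB.
    by apply: eq_bigr => c _; ring.
  rewrite exchange_big /=; apply: eq_bigr => b _.
  rewrite exchange_big /=; apply: eq_bigr => c _.
  rewrite (_ : p a b * _ * _ = P a * U a b c * (margYhat V a b * drift q V a b c));
    last by rewrite /p; ring.
  by rewrite margYhat_drift // mulr_sumr; apply: eq_bigr => y _; ring.
(* The identity part of [U] contributes nothing because [drift] vanishes on the diagonal. *)
have -> : \sum_a \sum_b \sum_c p a b * U a b c * drift q V a b c =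
    e * \sum_i drift q V (x i) (yh i) (x' i).
  transitivity (e * \sum_a \sum_b \sum_c N a b c * drift q V a b c).
    rewrite mulr_sumr; apply: eq_bigr => a _; rewrite mulr_sumr; apply: eq_bigr => b _.
    rewrite mulr_sumr; apply: eq_bigr => c _; rewrite pU.
    have [->|ac] := eqVneq a c; first by rewrite drift_diag; ring.
    by rewrite mul0r add0r mulrA.
  congr (_ * _).
  transitivity (\sum_a \sum_b \sum_c \sum_i (x i == a)%:R * ((yh i == b)%:R *
      ((x' i == c)%:R * (d i * drift q V a b c)))).
    apply: eq_bigr => a _; apply: eq_bigr => b _; apply: eq_bigr => c _.
    by rewrite mulr_suml; apply: eq_bigr => i _; ring.
  under eq_bigr do under eq_bigr do rewrite exchange_big /=.
  under eq_bigr do rewrite exchange_big /=.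
  rewrite exchange_big /=; apply: eq_bigr => i _.
  under eq_bigr do under eq_bigr do rewrite -mulr_sumr -mulr_sumr sum_delta.
  under eq_bigr do rewrite -mulr_sumr sum_delta.
  rewrite sum_delta /d; have [->|_] := eqVneq (x i) (x' i); last by rewrite mul1r.
  by rewrite drift_diag mulr0.
by rewrite pmulr_rge0.
Qed.

Lemma margYhat_ge0 (R : realType) (J K : nat) (V : 'I_J -> 'I_K * 'I_K -> R) a b :
  is_cond_pmf V -> 0 <= margYhat V a b.
Proof. by move=> VP; apply: sumr_ge0 => y _; have [+ _] := VP a; apply. Qed.

Lemma margYhat_pmf (R : realType) (J K : nat) (V : 'I_J -> 'I_K * 'I_K -> R) :
  is_cond_pmf V -> is_cond_pmf (margYhat V).
Proof.
move=> VP a; split=> [b|]; first exact: margYhat_ge0.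
have [_ <-] := VP a; rewrite exchange_big /= pair_bigA /=.
by apply: eq_bigr => -[].
Qed.

(* The fourth moment of the centred metric difference is at most a constant
   times its squared variance, uniformly in [n], since only finitely many
   single-letter laws occur. *)
Lemma overtaking_probability (R : realType) (J K : nat) (q : 'I_J -> 'I_K -> R)
    (V : 'I_J -> 'I_K * 'I_K -> R) :
  is_cond_pmf V ->
  exists2 c : R, 0 < c &
  forall (n : nat) (x x' : {ffun 'I_n -> 'I_J}) (yh : {ffun 'I_n -> 'I_K}),
    (forall i, 0 < margYhat V (x i) (yh i)) ->
    0 <= \sum_i drift q V (x i) (yh i) (x' i) ->
    c * chan_n (margYhat V) x yh <=
    \sum_(y : {ffun 'I_n -> 'I_K})
      (if metric_n q x y <= metric_n q x' y
       then \prod_i V (x i) (y i, yh i) else 0).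
Proof.
move=> VP.
pose w a b y := V a (y, b) / margYhat V a b.
pose z a b c y := q c y - q a y - drift q V a b c.
pose m k a b c := \sum_y w a b y * z a b c y ^+ k.
have V0 a y : 0 <= V a y by have [+ _] := VP a; apply.
have w_pmf a b : 0 < margYhat V a b -> is_pmf (w a b).
  move=> mab; split=> [y|]; first by rewrite divr_ge0 // ltW.
  by rewrite -mulr_suml divff // gt_eqF.
have z_mean a b c : 0 < margYhat V a b -> \sum_y w a b y * z a b c y = 0.
  move=> mab; have [_ w1] := w_pmf a b mab.
  under eq_bigr do rewrite mulrBr.
  by rewrite sumrB -mulr_suml w1 mul1r subrr.
have w0 a b y : 0 <= w a b y by rewrite divr_ge0 // margYhat_ge0.
have m_ge0 k a b c : 0 <= m k.*2 a b c.
  by apply: sumr_ge0 => y _; rewrite mulr_ge0 // -muln2 exprM sqr_ge0.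
(* The sum dominates each single-letter ratio. A letter triple with zero variance gives ratio 0 by
   division, and its fourth moment is 0 as well. *)
pose D := \sum_a \sum_b \sum_c m 4 a b c / m 2 a b c ^+ 2.
have t_ge0 a b c : 0 <= m 4 a b c / m 2 a b c ^+ 2.
  by rewrite divr_ge0 ?sqr_ge0 // (m_ge0 2).
have D0 : 0 <= D by do 3 (apply: sumr_ge0 => ? _).
have m4_le a b c : m 4 a b c <= D * m 2 a b c ^+ 2.
  have [v0|v0] := eqVneq (m 2 a b c) 0.
    rewrite v0 expr0n mulr0 /m big1 // => y _.
    have := psumr_eq0P (P := predT) (F := fun y => w a b y * z a b c y ^+ 2).
    move=> /(_ (fun y _ => mulr_ge0 (w0 a b y) (sqr_ge0 _)) v0 y isT) wz.
    have -> : w a b y * z a b c y ^+ 4 = w a b y * z a b c y ^+ 2 * z a b c y ^+ 2 by ring.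
    by rewrite wz mul0r.
  rewrite -ler_pdivrMr; last by rewrite exprn_gt0 // lt_def v0 (m_ge0 1).
  rewrite /D (bigD1 a) //= (bigD1 b) //= (bigD1 c) //= -!addrA lerDl.
  rewrite !addr_ge0 // sumr_ge0 // => ? _; rewrite ?sumr_ge0 // => ? _.
  by rewrite sumr_ge0.
exists (48 * (3 + D) ^+ 2)^-1; first by rewrite invr_gt0 mulr_gt0 // exprn_gt0 //; lra.
move=> n x x' yh mpos dr.
pose wi i := w (x i) (yh i); pose zi i := z (x i) (yh i) (x' i).
have wiP i : is_pmf (wi i) by exact: w_pmf.
have zi0 i : \sum_a wi i a * zi i a = 0 by exact: z_mean.
have := @pmf_nonneg_ge R {ffun 'I_n -> 'I_K} (fun y => \prod_i wi i (y i))
  (fun y => \sum_i zi i (y i)) (3 + D) (prod_pmf wiP).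
have m1 : \sum_(y : {ffun 'I_n -> 'I_K}) (\prod_i wi i (y i)) * \sum_i zi i (y i) = 0.
  apply: etrans (moment1 wiP zi0).
  by apply: eq_bigr => y _; rewrite expr1.
have m2 := moment2 wiP zi0.
have m4 := moment4_le D0 wiP zi0 (fun i => m4_le (x i) (yh i) (x' i)).
rewrite -m2 in m4.
move=> /(_ _ m1 m4) H.
have {}H : (48 * (3 + D) ^+ 2)^-1 <=
   \sum_(y : {ffun 'I_n -> 'I_K}) (if 0 <= \sum_i zi i (y i) then \prod_i wi i (y i) else 0).
  by apply: H; lra.
have ch0 : 0 <= chan_n (margYhat V) x yh.
  by apply: prodr_ge0 => i _; exact: margYhat_ge0.
apply: le_trans (ler_wpM2r ch0 H) _.
rewrite mulr_suml; apply: ler_sum => y _.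
(* Conditional law of [y] times the law of [yh] is the joint law. *)
have pV : \prod_i wi i (y i) * chan_n (margYhat V) x yh = \prod_i V (x i) (y i, yh i).
  rewrite -big_split /=; apply: eq_bigr => i _.
  by rewrite divfK // gt_eqF.
case: ifPn => S0; last first.
  by rewrite mul0r; case: ifP => // _; apply: prodr_ge0.
rewrite pV ifT // -subr_ge0 /metric_n -sumrB.
(* The metric difference is its centred part plus the total drift, and both are nonnegative here. *)
rewrite (_ : \sum_i _ = \sum_i zi i (y i) + \sum_i drift q V (x i) (yh i) (x' i)).
  by rewrite addr_ge0.
rewrite -big_split /=; apply: eq_bigr => i _; rewrite /zi /z; ring.
Qed.

(** * Tail, counting and growth estimates *)

Lemma chebyshev_prod (R : realType) (T : finType) (n : nat) (w z : 'I_n -> T -> R) (tau : R) :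
  0 < tau ->
  (forall i, is_pmf (w i)) -> (forall i, \sum_a w i a * z i a = 0) ->
  \sum_(f : {ffun 'I_n -> T}) (if tau < \sum_i z i (f i) then \prod_i w i (f i) else 0)
  <= (\sum_i \sum_a w i a * z i a ^+ 2) / tau ^+ 2.
Proof.
move=> t0 wP z0; rewrite -moment2 // /moment mulr_suml.
have [p0 _] := prod_pmf wP.
apply: ler_sum => f _; case: ifPn => [tS|_]; last first.
  by rewrite divr_ge0 ?sqr_ge0 // mulr_ge0 ?sqr_ge0.
rewrite ler_pdivlMr ?exprn_gt0 // ler_wpM2l //.
by rewrite ler_sqr ?nnegrE ltW // (lt_trans t0).
Qed.

Lemma sum_image_le (R : realType) (S T : finType) (A : {set S}) (f : S -> T) (F : T -> R) :
  (forall t, 0 <= F t) -> {in A &, injective f} ->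
  \sum_(s in A) F (f s) <= \sum_t F t.
Proof.
move=> F0 fA; rewrite -(big_imset F fA) /= [leRHS](bigID (mem (f @: A))) /= lerDl.
exact: sumr_ge0.
Qed.

(** The exponential splits into [d.+1] equal factors, each at least [a * n.+1%:R]. The [d.+1]-th
    factor [n.+1%:R] absorbs [c] and the powers of [a] once [n] is large. *)
Lemma poly_le_expR (R : realType) (d : nat) (c tau : R) : 0 < tau -> 0 <= c ->
  exists N : nat, forall n, (N <= n)%N -> c * n.+1%:R ^+ d <= expR (n%:R * tau).
Proof.
move=> t0 c0.
pose a : R := Num.min 1 (tau / d.+1%:R).
have a0 : 0 < a by rewrite lt_min ltr01 divr_gt0.
have a1 : a <= 1 by rewrite ge_min lexx.
have a2 : a <= tau / d.+1%:R by rewrite ge_min lexx orbT.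
pose B := c / a ^+ d.+1.
exists (Num.trunc B) => n Nn.
have Bn : B <= n.+1%:R.
  apply: ltW; apply: lt_le_trans (truncnS_gt B) _.
  by rewrite ler_nat ltnS.
have an : a * n.+1%:R <= expR (n%:R * (tau / d.+1%:R)).
  apply: le_trans (expR_ge1Dx _); rewrite -natr1 mulrDr mulr1 addrC.
  by rewrite lerD // mulrC ler_wpM2l.
have -> : expR (n%:R * tau) = expR (n%:R * (tau / d.+1%:R)) ^+ d.+1.
  by rewrite -expRM_natl; congr expR; rewrite mulrCA [_ * (tau / _)]mulrC divfK ?pnatr_eq0.
apply: le_trans (_ : (a * n.+1%:R) ^+ d.+1 <= _); last first.
  by rewrite lerXn2r // nnegrE ?expR_ge0 // mulr_ge0 // ltW.
rewrite exprMn [_ ^+ d.+1 in leRHS]exprSr.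
have : c <= a ^+ d.+1 * n.+1%:R by rewrite mulrC -ler_pdivrMr ?exprn_gt0.
move=> /(ler_wpM2r (exprn_ge0 d (ler0n R n.+1))) H; apply: le_trans H _.
by rewrite exprSr (exprSr n.+1%:R) le_eqVlt; apply/orP; left; apply/eqP; ring.
Qed.

(** * Codewords with the same joint type with the auxiliary output *)

(* The input letters outside the support of [P], on which [M_max] imposes no
   condition, are recorded position by position, so that codewords in the same
   class agree there. *)
Definition rare_pattern {R : realType} {J : nat} (P : 'I_J -> R) (a : 'I_J) : unit + 'I_J :=
  if P a == 0 then inr a else inl tt.

Definition joint_count {J K n : nat} (x : {ffun 'I_n -> 'I_J}) (y : {ffun 'I_n -> 'I_K})
  (a : 'I_J) (b : 'I_K) : nat := \sum_i ((x i == a) && (y i == b)).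

Lemma joint_count_lt (J K n : nat) (x : {ffun 'I_n -> 'I_J}) (y : {ffun 'I_n -> 'I_K}) a b :
  (joint_count x y a b < n.+1)%N.
Proof.
rewrite ltnS -[leqRHS]card_ord -sum1_card; apply: leq_sum => i _; exact: leq_b1.
Qed.

(** Counts live in ['I_n.+1], so each rare pattern carries only polynomially many classes. *)
Definition joint_class {R : realType} {J K n : nat} (P : 'I_J -> R)
    (x : {ffun 'I_n -> 'I_J}) (y : {ffun 'I_n -> 'I_K}) :
    {ffun 'I_n -> unit + 'I_J} * {ffun 'I_J * 'I_K -> 'I_n.+1} :=
  ([ffun i => rare_pattern P (x i)],
   [ffun ab => Ordinal (joint_count_lt x y ab.1 ab.2)]).

Definition confusable {R : realType} {J K n M : nat} (P : 'I_J -> R) (A : {set 'I_M})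
    (C : @codebook J n M) (y : {ffun 'I_n -> 'I_K}) (m : 'I_M) : bool :=
  [exists m' in A, (m' != m) && (joint_class P (C m) y == joint_class P (C m') y)].

Definition info_nats {R : realType} {J K : nat} (P : 'I_J -> R) (U : 'I_J -> 'I_K -> R) : R :=
  \sum_x P x * \sum_y U x y * ln (U x y / \sum_x' P x' * U x' y).

Lemma chan_n_pmf (R : realType) (J K n : nat) (U : 'I_J -> 'I_K -> R) (x : {ffun 'I_n -> 'I_J}) :
  is_cond_pmf U -> is_pmf (chan_n U x).
Proof. by move=> UP; exact: (@prod_pmf _ _ _ (fun i => U (x i))). Qed.

(* For fixed [y] a class contains at most one non-confusable codeword, so these
   are counted by summing, over [y] and over classes, a bound on [chan_n U (C m) y]
   that depends only on the class.  The reference measure [g] gives a rare letter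
   the small weight [t], which pays for the number of rare patterns. *)
Lemma confusable_mass (R : realType) (J K : nat) (P : 'I_J -> R) (U : 'I_J -> 'I_K -> R) (rho : R) :
  is_pmf P -> is_cond_pmf U -> info_nats P U < rho ->
  exists2 eta : R, 0 < eta & exists N : nat,
  forall (n M : nat) (C : codebook J n M) (A : {set 'I_M}),
    (N <= n)%N ->
    (forall m a, m \in A -> `|\sum_i (C m i == a)%:R - n%:R * P a| <= n%:R * eta) ->
    expR (n%:R * rho) <= #|A|%:R ->
    #|A|%:R / 2 <= \sum_(m in A) \sum_(y : {ffun 'I_n -> 'I_K})
      (if confusable P A C y m then chan_n U (C m) y else 0).
Proof.
move=> [P0 P1] UP Irho.
have U0 a b : 0 <= U a b by have [+ _] := UP a; apply.
have U1 a : \sum_b U a b = 1 by have [] := UP a.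
(* The gap is spent in quarters: on the composition error, on the deviation of the log-likelihood,
   on the rare patterns through [t], and on the number of count tables. *)
set delta := rho - info_nats P U; have d0 : 0 < delta by rewrite subr_gt0.
pose t := delta / (4 * J.+1%:R).
have t0 : 0 < t by rewrite divr_gt0 // mulr_gt0.
have Jt : J%:R * t <= delta / 4.
  have -> : delta / 4 = J.+1%:R * t by rewrite [RHS]mulrC /t invfM !mulrA divfK ?pnatr_eq0.
  by rewrite ler_wpM2r ?(ltW t0) // ler_nat.
pose Q b := \sum_a P a * U a b.
have Q0 b : 0 <= Q b by apply: sumr_ge0 => a _; rewrite mulr_ge0.
have Q1 : \sum_b Q b = 1.
  rewrite exchange_big /= -P1; apply: eq_bigr => a _.
  by rewrite -mulr_sumr U1 mulr1.
pose g (o : unit + 'I_J) b := if o is inr a then t * U a b else Q b.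
have g0 o b : 0 <= g o b by case: o => [_|a] //=; rewrite mulr_ge0 // ltW.
(* The logarithm of the density of [U a] with respect to the reference measure [g]. *)
pose h a b := if P a == 0 then - ln t else ln (U a b / Q b).
have hg a b : 0 < U a b -> U a b = expR (h a b) * g (rare_pattern P a) b.
  move=> Uab; rewrite /h /rare_pattern; case: ifPn => Pa /=.
    by rewrite expRN lnK ?posrE // mulKf // gt_eqF.
  have Qb : 0 < Q b.
    rewrite /Q (bigD1 a) //=; apply: ltr_pwDl.
      by rewrite mulr_gt0 // lt_def Pa P0.
    by apply: sumr_ge0 => *; rewrite mulr_ge0.
  by rewrite lnK ?posrE ?divr_gt0 // divfK // gt_eqF.
pose D a := \sum_b U a b * h a b.
have PD : \sum_a P a * D a = info_nats P U.
  apply: eq_bigr => a _; have [->|Pa] := eqVneq (P a) 0; first by rewrite !mul0r.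
  by congr (_ * _); apply: eq_bigr => b _; rewrite /h (negbTE Pa).
pose Dt := \sum_a `|D a|.
have Dt0 : 0 <= Dt by apply: sumr_ge0.
pose eta := delta / (4 * (Dt + 1)).
have eta0 : 0 < eta by rewrite divr_gt0 // mulr_gt0 //; lra.
have etaD : eta * Dt <= delta / 4.
  have -> : delta / 4 = eta * (Dt + 1) by rewrite /eta; field; lra.
  by rewrite ler_pM2l //; lra.
pose v a := \sum_b U a b * (h a b - D a) ^+ 2.
have v0 a : 0 <= v a by apply: sumr_ge0 => b _; rewrite mulr_ge0 ?sqr_ge0.
pose Bv := \sum_a v a.
have vB a : v a <= Bv by rewrite /Bv (bigD1 a) //= lerDl; apply: sumr_ge0.
have Bv0 : 0 <= Bv by apply: sumr_ge0.
have [N1 HN1] := @poly_le_expR R (J * K) 4 (delta / 4) ltac:(lra) ltac:(lra).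
exists eta => //.
(* Chebyshev gives the tail bound [16 * Bv / (n * delta ^+ 2)], which is at most 1/4 from
   [64 * Bv / delta ^+ 2] on. *)
exists (maxn N1 (Num.trunc (64 * Bv / delta ^+ 2)).+1) => n M C A.
rewrite geq_max => /andP[/HN1 {HN1} poly nB] comp size_A.
have n0 : 0 < n%:R :> R by rewrite ltr0n (leq_trans _ nB).
have {nB}nB : 64 * Bv / delta ^+ 2 <= n%:R.
  by apply: ltW; apply: lt_le_trans (truncnS_gt _) _; rewrite ler_nat.
pose mu := info_nats P U + delta / 2.
have mean m : m \in A -> \sum_i D (C m i) <= n%:R * (info_nats P U + delta / 4).
  move=> mA.
  have -> : \sum_i D (C m i) = \sum_a (\sum_i (C m i == a)%:R) * D a.
    transitivity (\sum_i \sum_a (C m i == a)%:R * D a).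
      by apply: eq_bigr => i _; rewrite sum_delta.
    by rewrite exchange_big; apply: eq_bigr => a _; rewrite mulr_suml.
  apply: le_trans (_ : \sum_a (n%:R * (P a * D a) + n%:R * (eta * `|D a|)) <= _).
    apply: ler_sum => a _; rewrite -lerBlDl.
    have -> : (\sum_i (C m i == a)%:R) * D a - n%:R * (P a * D a) =
      (\sum_i (C m i == a)%:R - n%:R * P a) * D a by ring.
    apply: le_trans (ler_norm _) _; rewrite normrM mulrA.
    by rewrite ler_wpM2r // comp.
  by rewrite big_split /= -!mulr_sumr PD -mulrDr ler_pM2l // lerD2l.
have tail m : m \in A ->
    \sum_(y : {ffun 'I_n -> 'I_K})
      (if n%:R * mu < \sum_i h (C m i) (y i) then chan_n U (C m) y else 0) <= 4^-1.
  move=> mA.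
  pose z i b := h (C m i) b - D (C m i).
  have z_mean i : \sum_b U (C m i) b * z i b = 0.
    under eq_bigr do rewrite mulrBr.
    by rewrite sumrB -mulr_suml U1 mul1r subrr.
  have := @chebyshev_prod R _ n (fun i => U (C m i)) z (n%:R * (delta / 4)).
  move=> /(_ ltac:(by rewrite mulr_gt0 // divr_gt0) (fun i => UP _) z_mean) cheb.
  apply: le_trans (le_trans _ cheb) _.
    apply: ler_sum => y _; case: ifPn => [hy|_].
      rewrite ifT // sumrB; have := mean m mA.
      by move: hy; rewrite /mu !mulrDr; lra.
    by case: ifP => // _; apply: prodr_ge0.
  have : \sum_i \sum_b U (C m i) b * z i b ^+ 2 <= n%:R * Bv.
    apply: le_trans (_ : \sum_(i < n) Bv <= _); first by apply: ler_sum => i _; exact: vB.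
    by rewrite sumr_const card_ord mulr_natl.
  move=> /le_trans H; rewrite ler_pdivrMr; last by rewrite exprn_gt0 // mulr_gt0 // divr_gt0.
  apply: H; move: nB; rewrite ler_pdivrMr ?exprn_gt0 // => nB.
  have -> : 4^-1 * (n%:R * (delta / 4)) ^+ 2 = n%:R * (n%:R * delta ^+ 2 / 64) by field.
  by rewrite ler_pM2l //; lra.
pose G (s : {ffun 'I_n -> unit + 'I_J}) (y : {ffun 'I_n -> 'I_K}) := \prod_i g (s i) (y i).
have G0 s y : 0 <= G s y by apply: prodr_ge0.
have chanG m (y : {ffun 'I_n -> 'I_K}) : \sum_i h (C m i) (y i) <= n%:R * mu ->
    chan_n U (C m) y <= expR (n%:R * mu) * G (joint_class P (C m) y).1 y.
  move=> hy; have [Upos|] := boolP [forall i, 0 < U (C m i) (y i)].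
    rewrite /chan_n /G (eq_bigr (fun i => expR (h (C m i) (y i)) *
      g ((joint_class P (C m) y).1 i) (y i))); last first.
      by move=> i _; rewrite ffunE; apply: hg; exact: (forallP Upos).
    rewrite big_split /= ler_wpM2r //; first exact: G0.
    by rewrite -expR_sum ler_expR.
  rewrite negb_forall => /existsP[i]; rewrite lt_def U0 andbT negbK => /eqP Ui.
  by rewrite /chan_n (bigD1 i) //= Ui mul0r mulr_ge0 ?expR_ge0.
(* The double sum factorises over positions into the [n]-th power of [1 + J%:R * t]. *)
have sumG : \sum_y \sum_s G s y <= expR (n%:R * (delta / 4)).
  rewrite (eq_bigr (fun y : {ffun 'I_n -> 'I_K} => \prod_i \sum_o g o (y i))); last first.
    by move=> y _; rewrite -(bigA_distr_bigA (fun i o => g o (y i))).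
  rewrite -(bigA_distr_bigA (fun i b => \sum_o g o b)) /=.
  rewrite prodr_const card_ord expRM_natl.
  rewrite lerXn2r ?nnegrE ?expR_ge0 //; first by do 2 apply: sumr_ge0 => ? _.
  apply: le_trans (expR_ge1Dx _).
  rewrite exchange_big big_sumType /= (big_pred1 tt) => [|[]//]; rewrite Q1 lerD2l.
  under eq_bigr do rewrite -mulr_sumr U1 mulr1.
  by rewrite sumr_const card_ord -[t *+ _]mulr_natl.
have unique_mass : \sum_(m in A) \sum_(y : {ffun 'I_n -> 'I_K})
    (if confusable P A C y m then 0
     else expR (n%:R * mu) * G (joint_class P (C m) y).1 y) <= #|A|%:R / 4.
  rewrite exchange_big /=.
  apply: le_trans (_ : \sum_(y : {ffun 'I_n -> 'I_K})
    \sum_(k : {ffun 'I_n -> unit + 'I_J} * {ffun 'I_J * 'I_K -> 'I_n.+1})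
      expR (n%:R * mu) * G k.1 y <= _).
    apply: ler_sum => y _.
    rewrite (eq_bigr (fun m => if ~~ confusable P A C y m then
      expR (n%:R * mu) * G (joint_class P (C m) y).1 y else 0)); last first.
      by move=> m _; rewrite if_neg.
    rewrite -big_mkcondr /= -big_set /=.
    apply: (@sum_image_le R _ _ _ (fun m => joint_class P (C m) y)
      (fun k => expR (n%:R * mu) * G k.1 y)) => [k|m m'].
      by rewrite mulr_ge0 ?expR_ge0.
    (* Two distinct codewords of [A] in one class would be confusable, so the class determines a
       non-confusable codeword. *)
    rewrite !inE => /andP[mA _] /andP[m'A nm'] eq_cls.
    apply/eqP; apply: contraNT nm' => neq; apply/existsP; exists m.
    by rewrite mA neq eq_cls eqxx.
  have -> : \sum_(y : {ffun 'I_n -> 'I_K})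
    \sum_(k : {ffun 'I_n -> unit + 'I_J} * {ffun 'I_J * 'I_K -> 'I_n.+1})
      expR (n%:R * mu) * G k.1 y =
    n.+1%:R ^+ (J * K) * (expR (n%:R * mu) * \sum_y \sum_s G s y).
    rewrite !mulr_sumr; apply: eq_bigr => y _.
    rewrite -(pair_bigA _ (fun s _ => expR (n%:R * mu) * G s y)) /=.
    rewrite !mulr_sumr; apply: eq_bigr => s _.
    by rewrite sumr_const card_ffun card_prod !card_ord -[LHS]mulr_natl natrX.
  apply: le_trans (_ : expR (n%:R * (delta / 4)) / 4 *
      (expR (n%:R * mu) * expR (n%:R * (delta / 4))) <= _).
    apply: ler_pM.
    - by rewrite exprn_ge0.
    - by rewrite mulr_ge0 ?expR_ge0 // sumr_ge0 // => y _; rewrite sumr_ge0.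
    - by rewrite ler_pdivlMr // mulrC.
    - by rewrite ler_wpM2l ?expR_ge0.
  have -> : expR (n%:R * (delta / 4)) / 4 * (expR (n%:R * mu) * expR (n%:R * (delta / 4)))
     = expR (n%:R * rho) / 4.
    rewrite mulrAC -!expRD; congr (expR _ / _); rewrite /mu /delta; by field.
  by rewrite ler_pM2r ?invr_gt0.
(* A non-confusable pair either has atypically large log-likelihood or obeys the class bound; each
   case carries at most a quarter of [#|A|]. *)
have bad_mass : \sum_(m in A) \sum_(y : {ffun 'I_n -> 'I_K})
    (if confusable P A C y m then 0 else chan_n U (C m) y) <= #|A|%:R / 2.
  apply: le_trans (_ : \sum_(m in A) \sum_(y : {ffun 'I_n -> 'I_K})
     ((if n%:R * mu < \sum_i h (C m i) (y i) then chan_n U (C m) y else 0) +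
      (if confusable P A C y m then 0
       else expR (n%:R * mu) * G (joint_class P (C m) y).1 y)) <= _).
    apply: ler_sum => m _; apply: ler_sum => y _.
    have ch0 : 0 <= chan_n U (C m) y by apply: prodr_ge0.
    case: ifP => _; first by rewrite addr0; case: ifP.
    case: ltP => hy; last by rewrite add0r chanG.
    by rewrite lerDl mulr_ge0 ?expR_ge0.
  under eq_bigr do rewrite big_split /=.
  rewrite big_split /=.
  have : \sum_(m in A) \sum_(y : {ffun 'I_n -> 'I_K})
     (if n%:R * mu < \sum_i h (C m i) (y i) then chan_n U (C m) y else 0) <= #|A|%:R / 4.
    by rewrite [leRHS]mulr_natl -sumr_const; apply: ler_sum.
  by lra.
have total : \sum_(m in A) \sum_(y : {ffun 'I_n -> 'I_K}) chan_n U (C m) y = #|A|%:R.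
  rewrite -sumr_const; apply: eq_bigr => m _.
  by have [] := chan_n_pmf (C m) UP.
rewrite (_ : \sum_(m in A) _ = #|A|%:R - \sum_(m in A) \sum_(y : {ffun 'I_n -> 'I_K})
    (if confusable P A C y m then 0 else chan_n U (C m) y)); last first.
  rewrite -total -sumrB; apply: eq_bigr => m _; rewrite -sumrB.
  by apply: eq_bigr => y _; case: ifP => _; rewrite ?subr0 ?subrr.
by lra.
Qed.

(** * From confusable codewords to decoding errors *)

Lemma joint_class_eq (R : realType) (J K n : nat) (P : 'I_J -> R)
    (x x' : {ffun 'I_n -> 'I_J}) (y : {ffun 'I_n -> 'I_K}) :
  joint_class P x y = joint_class P x' y ->
  (forall i, P (x i) = 0 -> x i = x' i) /\
  (forall a b, \sum_i ((x i == a) && (y i == b))%:R =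
               \sum_i ((x' i == a) && (y i == b))%:R :> R).
Proof.
move=> [/ffunP pat /ffunP cnt]; split=> [i Pi|a b].
  have := pat i; rewrite !ffunE /rare_pattern Pi eqxx.
  by case: ifP => // _ [].
have := cnt (a, b); rewrite !ffunE /= => /(congr1 val) /= c.
by rewrite -!natr_sum; congr (_%:R).
Qed.

Definition error_mass {R : realType} {J K n M : nat} (q W : 'I_J -> 'I_K -> R)
    (C : codebook J n M) (m : 'I_M) : R :=
  \sum_(y : {ffun 'I_n -> 'I_K})
     (if [exists m' : 'I_M, (m' != m) && (metric_n q (C m) y <= metric_n q (C m') y)]
      then chan_n W (C m) y else 0).

Lemma error_mass_ge0 (R : realType) (J K n M : nat) (q W : 'I_J -> 'I_K -> R)
    (C : codebook J n M) (m : 'I_M) : is_cond_pmf W -> 0 <= error_mass q W C m.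
Proof.
move=> WP; apply: sumr_ge0 => y _; case: ifP => // _.
by have [+ _] := chan_n_pmf (C m) WP; apply.
Qed.

Lemma error_mass_le1 (R : realType) (J K n M : nat) (q W : 'I_J -> 'I_K -> R)
    (C : codebook J n M) (m : 'I_M) : is_cond_pmf W -> error_mass q W C m <= 1.
Proof.
move=> WP; have [ch0 <-] := chan_n_pmf (C m) WP.
by apply: ler_sum => y _; case: ifP.
Qed.

(** The output law is split over [yh]. When [yh] makes [C m] confusable, the competitor has
    nonnegative total drift, hence overtakes with conditional probability at least [c];
    confusability has average probability at least 1/2. *)
Lemma subcode_error (R : realType) (J K : nat) (W q : 'I_J -> 'I_K -> R) (P : 'I_J -> R)
    (V : 'I_J -> 'I_K * 'I_K -> R) (rho : R) :
  is_pmf P -> M_max q P V -> margY V = W -> info_nats P (margYhat V) < rho ->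
  exists eta c : R, exists N : nat, [/\ 0 < eta, 0 < c &
  forall (n M : nat) (C : codebook J n M) (A : {set 'I_M}),
    (N <= n)%N ->
    (forall m a, m \in A -> `|\sum_i (C m i == a)%:R - n%:R * P a| <= n%:R * eta) ->
    expR (n%:R * rho) <= #|A|%:R ->
    c * #|A|%:R <= \sum_(m in A) error_mass q W C m].
Proof.
move=> PP VM VW Irho; have VP : is_cond_pmf V by case: VM.
have V0 a y : 0 <= V a y by have [+ _] := VP a; apply.
have [eta eta0 [N HN]] := confusable_mass PP (margYhat_pmf VP) Irho.
have [c c0 Hc] := overtaking_probability q VP.
exists eta, (c / 2), N; split=> [//||n M C A Nn comp size_A]; first by rewrite divr_gt0.
apply: le_trans (_ : c * (#|A|%:R / 2) <= _).
  by rewrite mulrAC mulrA.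
apply: le_trans (ler_wpM2l (ltW c0) (HN n M C A Nn comp size_A)) _.
rewrite mulr_sumr; apply: ler_sum => m _.
have chanW y : chan_n W (C m) y =
    \sum_(yh : {ffun 'I_n -> 'I_K}) \prod_i V (C m i) (y i, yh i).
  by rewrite -(bigA_distr_bigA (fun i b => V (C m i) (y i, b))) /chan_n -VW.
rewrite mulr_sumr /error_mass.
rewrite [leRHS](eq_bigr (fun y => \sum_(yh : {ffun 'I_n -> 'I_K})
  (if [exists m' : 'I_M, (m' != m) && (metric_n q (C m) y <= metric_n q (C m') y)]
   then \prod_i V (C m i) (y i, yh i) else 0))); last first.
  by move=> y _; case: ifP => _; [exact: chanW|rewrite big1].
rewrite exchange_big /=; apply: ler_sum => yh _.
have rhs0 : 0 <= \sum_(y : {ffun 'I_n -> 'I_K})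
  (if [exists m' : 'I_M, (m' != m) && (metric_n q (C m) y <= metric_n q (C m') y)]
   then \prod_i V (C m i) (y i, yh i) else 0).
  by apply: sumr_ge0 => y _; case: ifP => // _; apply: prodr_ge0.
case: ifPn => [/existsP[m' /and3P[_ mm' /eqP cls]]|_]; last by rewrite mulr0.
have [pos|] := boolP [forall i, 0 < margYhat V (C m i) (yh i)]; last first.
  rewrite negb_forall => /existsP[i].
  rewrite lt_def margYhat_ge0 // andbT negbK => /eqP Vi.
  by rewrite /chan_n (bigD1 i) //= Vi mul0r mulr0.
have {}pos i : 0 < margYhat V (C m i) (yh i) by exact: (forallP pos).
have [rare cnt] := joint_class_eq cls.
apply: le_trans (Hc n _ _ _ pos (M_max_drift_ge0 PP VM pos rare cnt)) _.
apply: ler_sum => y _; case: ifPn => [le|_].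
  by rewrite ifT //; apply/existsP; exists m'; rewrite mm'.
by case: ifP => // _; apply: prodr_ge0.
Qed.

(** * Mutual information and the value of the bound *)

Lemma mutual_info_nats (R : realType) (J K : nat) (P : 'I_J -> R) (U : 'I_J -> 'I_K -> R) :
  mutual_info P U * ln 2 = info_nats P U.
Proof.
have l2 : ln 2 != 0 :> R by rewrite gt_eqF // ln_gt0 // ltr1n.
rewrite mulr_suml; apply: eq_bigr => a _; rewrite mulr_suml mulr_sumr.
apply: eq_bigr => b _; rewrite [RHS]mulrA; case: ifP => [/eqP|] PU.
  by rewrite PU !mul0r.
by rewrite -mulrA divfK.
Qed.

Lemma ln_le_sub1 (R : realType) (x : R) : 0 < x -> ln x <= x - 1.
Proof. by move=> x0; have := @le_ln1Dx R (x - 1); rewrite [1 + _]addrC subrK; apply; lra. Qed.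

(** Gibbs' inequality: [U * ln (U / Q) >= U - Q] termwise, and the right side sums to zero. *)
Lemma info_nats_ge0 (R : realType) (J K : nat) (P : 'I_J -> R) (U : 'I_J -> 'I_K -> R) :
  is_pmf P -> is_cond_pmf U -> 0 <= info_nats P U.
Proof.
move=> [P0 P1] UP.
have U0 a b : 0 <= U a b by have [+ _] := UP a; apply.
have U1 a : \sum_b U a b = 1 by have [] := UP a.
have S1 : \sum_b \sum_x' P x' * U x' b = 1.
  rewrite exchange_big /= -P1; apply: eq_bigr => a _.
  by rewrite -mulr_sumr U1 mulr1.
have -> : 0 = \sum_a P a * \sum_b (U a b - \sum_x' P x' * U x' b) :> R.
  by rewrite big1 // => a _; rewrite sumrB U1 S1 subrr mulr0.
apply: ler_sum => a _; have [->|Pa] := eqVneq (P a) 0; first by rewrite !mul0r.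
apply: ler_wpM2l => //; apply: ler_sum => b _.
set Q := \sum_x' _.
have Q0 : 0 <= Q by apply: sumr_ge0 => *; rewrite mulr_ge0.
have [->|Uab] := eqVneq (U a b) 0; first by rewrite mul0r sub0r oppr_le0.
have Ub : 0 < U a b by rewrite lt_def Uab U0.
have Qb : 0 < Q.
  rewrite /Q (bigD1 a) //=; apply: ltr_pwDl.
    by rewrite mulr_gt0 // lt_def Pa P0.
  by apply: sumr_ge0 => *; rewrite mulr_ge0.
have := @ln_le_sub1 R (Q / U a b) (divr_gt0 Qb Ub).
have -> : ln (U a b / Q) = - ln (Q / U a b) by rewrite -lnV ?posrE ?divr_gt0 // invf_div.
move=> /(ler_wpM2l (U0 a b)); rewrite mulrBr mulr1 mulrCA divff // mulr1; lra.
Qed.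

(** A crude bound, serving to make the supremum in [Rbar] finite: from [ln x <= x] and
    [P a * U a b <= Q], each term is at most [U a b]. *)
Lemma info_nats_le (R : realType) (J K : nat) (P : 'I_J -> R) (U : 'I_J -> 'I_K -> R) :
  is_pmf P -> is_cond_pmf U -> info_nats P U <= J%:R.
Proof.
move=> [P0 P1] UP.
have U0 a b : 0 <= U a b by have [+ _] := UP a; apply.
have -> : J%:R = \sum_a \sum_b U a b :> R.
  rewrite (eq_bigr (fun=> 1)); last by move=> a _; have [] := UP a.
  by rewrite sumr_const card_ord.
apply: ler_sum => a _; rewrite mulr_sumr; apply: ler_sum => b _; rewrite mulrA.
have [->|PU] := eqVneq (P a * U a b) 0; first by rewrite mul0r.
set Q := \sum_x' _.
have PU0 : 0 < P a * U a b by rewrite lt_def PU mulr_ge0.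
have Ub : 0 < U a b by rewrite lt_def U0 andbT; apply: contraNneq PU => ->; rewrite mulr0.
have PUQ : P a * U a b <= Q.
  by rewrite /Q (bigD1 a) //= lerDl; apply: sumr_ge0 => *; rewrite mulr_ge0.
have Q0 : 0 < Q by apply: lt_le_trans PUQ.
apply: le_trans (_ : P a * U a b * (U a b / Q) <= _).
  rewrite ler_pM2l //; apply: le_trans (ln_le_sub1 (divr_gt0 Ub Q0)) _; lra.
by rewrite mulrA ler_pdivrMr // mulrC ler_pM2l.
Qed.

(** The coupling with [yhat = y], which shows that the constraint set of the minimum is nonempty. *)
Definition diag_channel {R : realType} {J K : nat} (W : 'I_J -> 'I_K -> R)
    (a : 'I_J) (y : 'I_K * 'I_K) : R := (y.1 == y.2)%:R * W a y.1.

Arguments diag_channel : simpl never.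

Lemma margY_diag (R : realType) (J K : nat) (W : 'I_J -> 'I_K -> R) :
  margY (diag_channel W) = W.
Proof. by apply/funext => a; apply/funext => b; rewrite /margY sum_delta. Qed.

(** When [yhat = y] the marginal condition fixes the law of the second input with [y], so the two
    metric means coincide. *)
Lemma M_max_diag (R : realType) (J K : nat) (W q : 'I_J -> 'I_K -> R) (P : 'I_J -> R) :
  is_cond_pmf W -> M_max q P (diag_channel W).
Proof.
move=> WP; split=> [a|U UP marg].
  split=> [y|]; first by rewrite mulr_ge0 ?ler0n //; have [+ _] := WP a; apply.
  have [_ <-] := WP a; rewrite -{2}(margY_diag W) /margY pair_bigA /=.
  by apply: eq_bigr => -[].
have swap (a x : 'I_J) y b : diag_channel W a (y, b) * q x y = diag_channel W a (y, b) * q x b.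
  by rewrite /diag_channel /=; case: eqP => [->//|_]; rewrite !mul0r.
rewrite le_eqVlt; apply/orP; left; apply/eqP.
transitivity (\sum_b \sum_c (\sum_y P c * diag_channel W c (y, b)) * q c b).
  rewrite [RHS]exchange_big /=; apply: eq_bigr => a _.
  rewrite exchange_big /=; apply: eq_bigr => b _.
  by rewrite mulr_suml; apply: eq_bigr => y _; rewrite -mulrA swap mulrA.
under eq_bigr do under eq_bigr do rewrite -marg mulr_suml.
under eq_bigr do rewrite exchange_big /=.
rewrite exchange_big /=; apply: eq_bigr => a _.
rewrite [RHS]exchange_big /=; apply: eq_bigr => b _.
under eq_bigr do rewrite mulr_suml.
rewrite exchange_big /=; apply: eq_bigr => y _; apply: eq_bigr => c _.
transitivity (diag_channel W a (y, b) * q c b * (P a * U a b c)); first by ring.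
by rewrite -swap; ring.
Qed.

(** * Compactness, lower limits and the pigeonhole principle *)

Lemma seq_pos_lbound (R : realType) (T : eqType) (s : seq T) (c : T -> R) :
  (forall v, v \in s -> 0 < c v) ->
  exists2 c0 : R, 0 < c0 & forall v, v \in s -> c0 <= c v.
Proof.
elim: s => [|v s IH] cs; first by exists 1.
have [c0 c00 H] := IH (fun u us => cs u (@mem_behead _ (v :: s) u us)).
exists (Num.min c0 (c v)); first by rewrite lt_min c00 cs ?mem_head.
move=> u; rewrite inE => /orP[/eqP ->|/H cu]; first by rewrite ge_min lexx orbT.
by rewrite ge_min cu.
Qed.

(** The radius may vary with the centre without any continuity: it will come from a channel chosen
    separately for each input law. *)
Lemma simplex_cover (R : realType) (J : nat) (r : 'rV[R]_J -> R) :
  (forall v : 'rV[R]_J, is_pmf (v ord0) -> 0 < r v) ->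
  exists2 s : seq 'rV[R]_J, (forall v : 'rV[R]_J, v \in s -> is_pmf (v ord0)) &
    forall p : 'I_J -> R, is_pmf p ->
      exists2 v : 'rV[R]_J, v \in s & forall a, `|p a - v ord0 a| <= r v.
Proof.
move=> r0.
pose A : set 'rV[R]_J := [set v : 'rV[R]_J | is_pmf (v ord0)]%classic.
have cptA : compact A.
  pose B : set 'rV[R]_J := [set v : 'rV[R]_J | forall a, `[0%R, 1%R]%classic (v ord0 a)]%classic.
  have cptB : compact B by apply: (@rV_compact _ _ (fun=> `[0%R : R, 1%R]%classic)) => a;
    exact: segment_compact.
  have -> : A = (B `&` [set v : 'rV[R]_J | \sum_a v ord0 a = 1])%classic.
    apply/seteqP; split=> v /=.
      move=> [v0 v1]; split=> // a; rewrite /= in_itv /= v0 -v1 /=.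
      by rewrite (bigD1 a) //= lerDl; apply: sumr_ge0.
    move=> [vB v1]; split=> // a; have := vB a.
    by rewrite /= in_itv /= => /andP[].
  apply: compact_closedI => //.
  have cont : continuous (fun v : 'rV[R]_J => \sum_a v ord0 a).
    apply: continuous_big => [|a _]; first exact: add_continuous.
    exact: coord_continuous.
  apply: (@preimage_closed _ _ (fun v : 'rV[R]_J => \sum_a v ord0 a) [set x | x = 1]%classic).
    by move=> v _; exact: cont.
  exact: closed_eq.
rewrite compact_cover in cptA.
have [||D DA DB] := cptA _ A (fun v => interior (ball v (r v))).
- by move=> v _; exact: open_interior.
- move=> v Av; exists v => //; exact: nbhsx_ballx (r0 v Av).
exists (finmap.enum_fset D) => [v vD|p pP].
  by have := DA v vD; rewrite inE.
have [|v vD] := DB (\row_a p a).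
  by rewrite /A /= (_ : (\row_a p a) ord0 = p) //; apply/funext => a; rewrite mxE.
move=> /interior_subset [_ bl]; exists v => // a.
have := bl ord0 a; rewrite mxE /ball /= => /ltW; by rewrite distrC.
Qed.

Lemma limn_inf0_frequently (R : realType) (u : nat -> R) (c : R) (N : nat) :
  (forall n, 0 <= u n <= 1) -> limn_inf u = 0 -> 0 < c ->
  exists2 n, (N <= n)%N & u n < c.
Proof.
move=> u01 liminf c0; apply: contrapT => H.
have cu n : (N <= n)%N -> c <= u n.
  by move=> Nn; rewrite leNgt; apply/negP => un; apply: H; exists n.
have bu : bounded_fun u.
  exists 1; split; first exact: num_real.
  move=> t t1 n _ /=; have /andP[un0 un1] := u01 n.
  by rewrite ger0_norm // (le_trans un1) // ltW.
have lbu n : has_lbound (sdrop u n).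
  by exists 0 => _ [k _ <-]; have /andP[] := u01 k.
have : c <= limn_inf u.
  rewrite limn_infE //; apply: le_trans (_ : infs u N <= _).
    apply: lb_le_inf; first by exists (u N); exists N => /=.
    by move=> _ [k Nk <-]; apply: cu.
  apply: ub_le_sup; last by exists N.
  exists 1 => _ [n _ <-]; have /andP[_ un1] := u01 n.
  apply: le_trans un1; apply: ge_inf => //; by exists n => /=.
by rewrite liminf leNgt c0.
Qed.

Lemma pigeonhole_seq (T : eqType) (M : nat) (s : seq T) (A : T -> {set 'I_M}) :
  (forall m, exists2 v, v \in s & m \in A v) -> (0 < M)%N ->
  exists2 v, v \in s & (M <= size s * #|A v|)%N.
Proof.
move=> cov M0.
have [/hasP[v vs vM]|/hasPn H] := boolP (has (fun v => M <= size s * #|A v|)%N s).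
  by exists v.
have s0 : (0 < size s)%N by have [v] := cov (Ordinal M0); case: (s).
have le1 : (M <= \sum_(v <- s) #|A v|)%N.
  rewrite (eq_bigr (fun v => \sum_(m < M) (m \in A v : nat)))%N; last first.
    by move=> v _; rewrite -sum1_card big_mkcond.
  rewrite exchange_big /= -[leqLHS]card_ord -sum1_card; apply: leq_sum => m _.
  have [v vs mv] := cov m.
  by rewrite (big_rem v) //= mv.
have : (size s * M <= size s * \sum_(v <- s) #|A v|)%N by rewrite leq_mul2l le1 orbT.
rewrite big_distrr /= leqNgt => /negP[].
apply: leq_ltn_trans (_ : \sum_(v <- s) M.-1 * 1 < _)%N.
  rewrite big_seq [leqRHS]big_seq; apply: leq_sum => v vs.
  by rewrite muln1 -ltnS prednK // ltnNge; exact: H.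
by rewrite -big_distrr /= sum1_size [(M.-1 * _)%N]mulnC ltn_mul2l s0 ltn_predL.
Qed.

(** * The infima and the supremum defining the bound *)

Lemma has_inf_info (R : realType) (J K : nat) (W q : 'I_J -> 'I_K -> R) (P : 'I_J -> R) :
  is_cond_pmf W -> is_pmf P ->
  has_inf [set mutual_info P (margYhat V) | V in [set V | M_max q P V /\ margY V = W]]%classic
  /\ lbound [set mutual_info P (margYhat V) | V in [set V | M_max q P V /\ margY V = W]]%classic 0.
Proof.
move=> WP PP.
have lb : lbound [set mutual_info P (margYhat V) |
    V in [set V | M_max q P V /\ margY V = W]]%classic 0.
  move=> _ [V [[VP _] _] <-].
  have l2 : 0 < ln 2 :> R by rewrite ln_gt0 // ltr1n.
  by rewrite -(pmulr_lge0 _ l2) mutual_info_nats info_nats_ge0 //; exact: margYhat_pmf.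
split=> //; split; last by exists 0.
exists (mutual_info P (margYhat (diag_channel W))); exists (diag_channel W) => //.
by split; [exact: M_max_diag|exact: margY_diag].
Qed.

(** The set of infima must be bounded above for [sup] to dominate its members; the diagonal coupling
    bounds every infimum by [J%:R / ln 2]. *)
Lemma Rbar_ge (R : realType) (J K : nat) (W q : 'I_J -> 'I_K -> R) (P : 'I_J -> R) :
  is_cond_pmf W -> is_pmf P ->
  inf [set mutual_info P (margYhat V) | V in [set V | M_max q P V /\ margY V = W]]%classic
  <= Rbar W q.
Proof.
move=> WP PP; apply: ub_le_sup; last by exists P.
exists (J%:R / ln 2) => _ [P' P'P <-].
have [[_ lb] _] := has_inf_info q WP P'P.
apply: le_trans (ge_inf lb _) (_ : mutual_info P' (margYhat (diag_channel W)) <= _).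
  by exists (diag_channel W) => //; split; [exact: M_max_diag|exact: margY_diag].
rewrite ler_pdivlMr ?ln_gt0 ?ltr1n // mutual_info_nats info_nats_le //.
by apply: margYhat_pmf; case: (M_max_diag q P' WP).
Qed.

Lemma Rbar_ge0 (R : realType) (J K : nat) (W q : 'I_J -> 'I_K -> R) :
  is_cond_pmf W -> 0 <= Rbar W q.
Proof.
move=> WP; have [[P PP]|noP] := pselect (exists P : 'I_J -> R, is_pmf P).
  apply: le_trans (Rbar_ge q WP PP).
  have [[ne _] lb] := has_inf_info q WP PP; exact: lb_le_inf.
(* With no input law at all, as for [J = 0], the supremum takes its default value 0. *)
rewrite /Rbar (_ : [set P | is_pmf P]%classic = set0) ?image_set0 ?sup0 //.
by apply/seteqP; split=> // P PP; apply: noP; exists P.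
Qed.

(** * Error probability at rates above the bound *)

Lemma empirical_pmf (R : realType) (J n : nat) (x : {ffun 'I_n -> 'I_J}) :
  (0 < n)%N -> is_pmf (fun a => (\sum_i (x i == a)%:R) / n%:R : R).
Proof.
move=> n0; split=> [a|]; first by rewrite divr_ge0 // sumr_ge0.
rewrite -mulr_suml exchange_big /= (eq_bigr (fun=> 1)).
  by rewrite sumr_const card_ord divff // pnatr_eq0 -lt0n.
move=> i _; rewrite -[RHS](sum_delta (x i) (fun=> 1)).
by apply: eq_bigr => a _; rewrite mulr1.
Qed.

(** Finitely many centres cover all compositions, so some centre attracts a fixed fraction of the
    codewords, and [subcode_error] applies to them. *)
Lemma error_above_Rbar (R : realType) (J K : nat) (W q : 'I_J -> 'I_K -> R) (rho : R) :
  is_cond_pmf W -> Rbar W q < rho ->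
  exists2 c : R, 0 < c & exists N : nat, forall n M (C : codebook J n M),
    (N <= n)%N -> 2 `^ (n%:R * rho) <= M%:R -> c <= err_prob q W C.
Proof.
move=> WP Rrho.
have l2 : 0 < ln 2 :> R by rewrite ln_gt0 // ltr1n.
(* One half of the gap pays for a nearly optimal [V], the other for the rate lost by the pigeonhole
   principle. *)
pose e := (rho - Rbar W q) / 2; have e0 : 0 < e by rewrite divr_gt0 // subr_gt0.
pose good (v : 'rV[R]_J) (t : R * R * nat) := is_pmf (v ord0) ->
  [/\ 0 < t.1.1, 0 < t.1.2 &
  forall (n M : nat) (C : codebook J n M) (A : {set 'I_M}),
    (t.2 <= n)%N ->
    (forall m a, m \in A -> `|\sum_i (C m i == a)%:R - n%:R * v ord0 a| <= n%:R * t.1.1) ->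
    expR (n%:R * ((rho - e) * ln 2)) <= #|A|%:R ->
    t.1.2 * #|A|%:R <= \sum_(m in A) error_mass q W C m].
have [f Hf] : {f : 'rV[R]_J -> R * R * nat & forall v, good v (f v)}.
  apply: choice => v; have [vP|] := pselect (is_pmf (v ord0)); last first.
    by exists (0, 0, 0%N).
  have [hinf _] := has_inf_info q WP vP.
  have [_ [V [VM VW] <-] Vlt] := inf_adherent e0 hinf.
  have : info_nats (v ord0) (margYhat V) < (rho - e) * ln 2.
    rewrite -mutual_info_nats ltr_pM2r // (lt_le_trans Vlt) //.
    by have := Rbar_ge q WP vP; rewrite /e; lra.
  move=> /(subcode_error vP VM VW)[eta [c [N [eta0 c0 H]]]].
  by exists (eta, c, N) => _; split.
have [s s_pmf s_cover] := @simplex_cover R J (fun v => (f v).1.1)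
  (fun v vP => let: And3 h _ _ := Hf v vP in h).
have [c0 c00 c0_le] := @seq_pos_lbound R _ s (fun v => (f v).1.2)
  (fun v vs => let: And3 _ h _ := Hf v (s_pmf v vs) in h).
have [N1 HN1] := @poly_le_expR R 0 (size s)%:R (e * ln 2) (mulr_gt0 e0 l2) (ler0n _ _).
(* The chosen subcode holds at least a fraction [1 / size s] of the messages; the successor keeps
   the denominator positive. *)
exists (c0 / (size s).+1%:R); first by rewrite divr_gt0.
exists (maxn 1 (maxn N1 (\max_(v <- s) (f v).2))) => n M C.
rewrite !geq_max => /and3P[n0 /HN1]; rewrite expr0 mulr1 => sN maxN sizeM.
have nR0 : 0 < n%:R :> R by rewrite ltr0n.
have M0 : (0 < M)%N.
  by rewrite -(ltr0n R); apply: lt_le_trans sizeM; rewrite powR_gt0.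
pose A (v : 'rV[R]_J) := [set m : 'I_M |
  [forall a, `|\sum_i (C m i == a)%:R - n%:R * v ord0 a| <= n%:R * (f v).1.1]].
have [m|v vs Mle] := @pigeonhole_seq _ M s A _ M0.
  have [v vs Hv] := s_cover _ (empirical_pmf R (C m) n0).
  exists v => //; rewrite inE; apply/forallP => a.
  rewrite (_ : _ - _ = n%:R * ((\sum_i (C m i == a)%:R) / n%:R - v ord0 a)); last first.
    by rewrite mulrBr mulrCA divff ?mulr1 // gt_eqF.
  by rewrite normrM (ger0_norm (ltW nR0)) ler_pM2l.
have MleR : M%:R <= (size s)%:R * #|A v|%:R :> R by rewrite -natrM ler_nat.
have size0 : 0 < (size s)%:R :> R by rewrite ltr0n; case: (s) vs.
have [_ _ Hv] := Hf v (s_pmf v vs).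
have sumA : (f v).1.2 * #|A v|%:R <= \sum_(m in A v) error_mass q W C m.
  apply: Hv => [|m a|].
  - by apply: leq_trans maxN; apply: leq_bigmax_seq.
  - by rewrite inE => /forallP /(_ a).
  - rewrite -(ler_pM2l size0); apply: le_trans MleR; apply: le_trans sizeM.
    rewrite /powR pnatr_eq0 /=.
    apply: le_trans (ler_wpM2r (expR_ge0 _) sN) _.
    by rewrite -expRD ler_expR le_eqVlt; apply/orP; left; apply/eqP; ring.
rewrite /err_prob [leRHS]mulrC ler_pdivlMr ?ltr0n //.
apply: le_trans (_ : \sum_(m in A v) error_mass q W C m <= _); last first.
  rewrite [leRHS](bigID (mem (A v))) /= lerDl; apply: sumr_ge0 => m _.
  exact: error_mass_ge0.
apply: le_trans sumA; apply: le_trans (_ : c0 * #|A v|%:R <= _); last first.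
  by rewrite ler_wpM2r // c0_le.
rewrite -mulrA ler_pM2l // mulrC ler_pdivrMr //.
by apply: le_trans MleR _; rewrite mulrC ler_wpM2l // ler_nat.
Qed.

Theorem theorem1 (R : realType) (J K : nat)
  (W : 'I_J -> 'I_K -> R) (q : 'I_J -> 'I_K -> R) :
  is_cond_pmf W ->
  mismatch_capacity q W <= Rbar W q.
Proof.
move=> WP; rewrite /mismatch_capacity.
have [[r0 ach0]|none] := pselect (exists r, achievable q W r); last first.
  (* Without achievable rates the capacity is the default 0 of [sup]. *)
  rewrite (_ : [set r | achievable q W r]%classic = set0) ?sup0 ?Rbar_ge0 //.
  by apply/seteqP; split=> // r ar; apply: none; exists r.
apply: ge_sup; first by exists r0.
move=> r [_ ach]; rewrite leNgt; apply/negP => Rr.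
pose eps := (r - Rbar W q) / 2.
have [|M [C [sizeM liminf]]] := ach eps; first by rewrite divr_gt0 // subr_gt0.
have [|c c0 [N HN]] := @error_above_Rbar R J K W q (r - eps) WP; first by rewrite /eps; lra.
(* A zero lower limit puts the error below [c] at some [n >= N], against the uniform bound at rate
   [r - eps]. *)
have [n|n Nn] := @limn_inf0_frequently R (fun n => err_prob q W (C n)) c N _ liminf c0.
  have s0 : 0 <= \sum_m error_mass q W (C n) m.
    by apply: sumr_ge0 => m _; exact: error_mass_ge0.
  rewrite mulr_ge0 ?invr_ge0 //=.
  have M0 : 0 < (M n)%:R :> R by apply: lt_le_trans (sizeM n); rewrite powR_gt0.
  rewrite /err_prob mulrC ler_pdivrMr // mul1r.
  rewrite -[M n in leRHS]card_ord -sumr_const; apply: ler_sum => m _.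
  exact: error_mass_le1.
by rewrite ltNge HN.
Qed.
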